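(* Let $0<p<1$. For each $\varepsilon$ in an interval $(0,\varepsilon_0)$, let $\{(n_m,\lambda,\rho)\}_{m\in\mathbb{N}}$, with $(\lambda,\rho)=(\lambda_\varepsilon,\rho_\varepsilon)$ depending on $\varepsilon$, be a sequence of LDPC ensembles with block lengths tending to infinity, transmitted over a binary erasure channel with erasure probability $p$, which achieves a fraction $1-\varepsilon$ of the channel capacity under message-passing decoding. Let $L_2(\varepsilon)$ be the fraction of degree-$2$ variable nodes, and let $l(\varepsilon,p,P_{\mathrm b})$ be the number of iterations required, in the limit of infinite block length, to achieve an average bit erasure probability $P_{\mathrm b}$ (a fixed number $P_{\mathrm b}\ge0$). If the limit $\lim_{\varepsilon\to0}L_2(\varepsilon)$ is strictly positive and $P_{\mathrm b}<p\,L_2(\varepsilon)$, then $$l(\varepsilon,p,P_{\mathrm b})=\Omega\!\left(\frac1\varepsilon\right)\qquad\text{as }\varepsilon\to0 .$$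
   Context: Degree distributions. An LDPC ensemble $(n,\lambda,\rho)$ has edge-perspective degree distributions $\lambda(x)=\sum_{i\ge2}\lambda_i x^{i-1}$ (variable nodes) and $\rho(x)=\sum_{i\ge1}\rho_i x^{i-1}$ (parity-check nodes), with non-negative coefficients and $\lambda(1)=\rho(1)=1$. The node-perspective left degree distribution is $L(x)=\sum_{i\ge2}L_ix^i=\int_0^x\lambda(t)\,dt\big/\int_0^1\lambda(t)\,dt$, so $L_i$ is the fraction of variable nodes of degree $i$. The design rate is $R=1-\int_0^1\rho(t)\,dt\big/\int_0^1\lambda(t)\,dt$. Asymptotic analysis (density evolution, flooding schedule). In the limit of infinite block length, the expected fraction of erasures in variable-to-check messages at iteration $l=0,1,2,\dots$ is $x^{(l)}$, where $x^{(0)}=p$ and $x^{(l+1)}=p\,\lambda\bigl(1-\rho(1-x^{(l)})\bigr)$. The average bit erasure probability after iteration $l$ is $P_{\mathrm b}^{(l)}=p\,L\bigl(1-\rho(1-x^{(l)})\bigr)$. Achieving a fraction of capacity. The capacity of the BEC is $C=1-p$. The sequence achieves a fraction $1-\varepsilon$ of the channel capacity under message-passing decoding if its (design) rate satisfies $R\ge(1-\varepsilon)C$ and the achievable bit erasure probability vanishes, i.e. $P_{\mathrm b}^{(l)}\to0$ as $l\to\infty$. Number of iterations. Since iterations are counted starting from $0$, $l(\varepsilon,p,P_{\mathrm b})$ is the smallest integer $l\ge1$ with $P_{\mathrm b}^{(l-1)}\le P_{\mathrm b}$ (it is $\infty$ if there is none). Notation. $f(\varepsilon)=\Omega(g(\varepsilon))$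 means that there are positive constants $c,\delta$, not depending on $\varepsilon$, such that $0\le c\,g(\varepsilon)\le f(\varepsilon)$ for all $0<\varepsilon\le\delta$. The condition $P_{\mathrm b}<pL_2(\varepsilon)$ is assumed for all $\varepsilon$ considered. *)

(* Defs.v *)
From Stdlib Require Import Reals Lra Lia.
From Coquelicot Require Import Coquelicot.

Open Scope R_scope.

(* Edge-perspective degree distribution: [coef i] is the fraction of edges
   attached to nodes of degree [i], and degrees start at [imin].  The support is
   allowed to be infinite. *)
Record degree_distribution (imin : nat) : Type := DegreeDistribution {
  coef :> nat -> R;
  coef_ge0 : forall i, 0 <= coef i;
  coef_min : forall i, (i < imin)%nat -> coef i = 0;
  coef_sum : is_series coef 1
}.

Arguments coef {imin} _ _.

(* The exponent is shifted: degree [i] contributes [coef i * x ^ (i - 1)]. *)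
Definition edge_coef {imin : nat} (d : degree_distribution imin) (k : nat) : R :=
  d (S k).

Definition edge_poly {imin : nat} (d : degree_distribution imin) (x : R) : R :=
  PSeries (edge_coef d) x.

Definition node_poly {imin : nat} (d : degree_distribution imin) (x : R) : R :=
  RInt (edge_poly d) 0 x / RInt (edge_poly d) 0 1.

(* [i]-th coefficient of the power series of [node_poly d] (see
   [node_poly_pseries]): [(d i / i) / int_0^1 (edge_poly d)]. *)
Definition node_coef {imin : nat} (d : degree_distribution imin) (i : nat) : R :=
  PS_Int (edge_coef d) i / RInt (edge_poly d) 0 1.

(* An LDPC ensemble sequence [(n_m, lambda, rho)], m = 0, 1, 2, ... *)
Record ldpc_sequence : Type := LDPCSequence {
  block_length : nat -> nat;
  vdeg : degree_distribution 2;
  cdeg : degree_distribution 1;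
  block_length_infty : filterlim block_length eventually eventually
}.

Definition design_rate (E : ldpc_sequence) : R :=
  1 - RInt (edge_poly (cdeg E)) 0 1 / RInt (edge_poly (vdeg E)) 0 1.

(* Density evolution describes the limit m -> infinity of the sequence, so
   [block_length] does not enter the recursion. *)
Fixpoint erasure_fraction (E : ldpc_sequence) (p : R) (l : nat) : R :=
  match l with
  | O => p
  | S l' =>
      p * edge_poly (vdeg E)
            (1 - edge_poly (cdeg E) (1 - erasure_fraction E p l'))
  end.

Definition bit_erasure_prob (E : ldpc_sequence) (p : R) (l : nat) : R :=
  p * node_poly (vdeg E)
        (1 - edge_poly (cdeg E) (1 - erasure_fraction E p l)).

Definition bec_capacity (p : R) : R := 1 - p.

Definition achieves_capacity_fraction (E : ldpc_sequence) (p eps : R) : Prop :=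
  (1 - eps) * bec_capacity p <= design_rate E /\
  is_lim_seq (bit_erasure_prob E p) 0.

Definition enough_iterations (E : ldpc_sequence) (p Pb : R) (l : nat) : Prop :=
  (1 <= l)%nat /\ bit_erasure_prob E p (l - 1) <= Pb.

Lemma enough_iterations_dec (E : ldpc_sequence) (p Pb : R) (l : nat) :
  enough_iterations E p Pb l \/ ~ enough_iterations E p Pb l.
Proof.
unfold enough_iterations.
destruct (Rle_dec (bit_erasure_prob E p (l - 1)) Pb);
  destruct (Compare_dec.le_dec 1 l); tauto.
Qed.

(* The least [l] with [enough_iterations E p Pb l], or [p_infty] if none. *)
Definition num_iterations (E : ldpc_sequence) (p Pb : R) : Rbar :=
  match LPO_min (enough_iterations E p Pb) (enough_iterations_dec E p Pb) with
  | inleft s => Finite (INR (proj1_sig s))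
  | inright _ => p_infty
  end.

(* [f = Omega(g)] as eps -> 0+, for a possibly infinite [f]. *)
Definition is_Omega_at_0 (f : R -> Rbar) (g : R -> R) : Prop :=
  exists c delta : R, 0 < c /\ 0 < delta /\
    forall eps : R, 0 < eps <= delta ->
      0 <= c * g eps /\ Rbar_le (Finite (c * g eps)) (f eps).

Lemma edge_coef_radius (imin : nat) (d : degree_distribution imin) (x : R) :
  0 <= x < 1 -> Rbar_lt (Rabs x) (CV_radius (edge_coef d)).
Proof.
intros Hx.
apply Rbar_lt_le_trans with (Finite 1).
{ simpl; rewrite Rabs_pos_eq; lra. }
destruct (CV_radius_bounded (edge_coef d)) as [Hub _].
apply Hub.
assert (Hs : ex_finite_lim_seq (coef d)).
{ exists 0; apply ex_series_lim_0; exists 1; apply coef_sum. }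
destruct (filterlim_bounded (coef d) Hs) as [M HM].
exists M; intros n; rewrite pow1, Rmult_1_r; apply (HM (S n)).
Qed.

Lemma node_poly_pseries (imin : nat) (d : degree_distribution imin) (x : R) :
  0 <= x < 1 -> is_pseries (node_coef d) x (node_poly d x).
Proof.
intros Hx.
pose proof (is_pseries_RInt _ _ (edge_coef_radius imin d x Hx)) as H.
apply (is_pseries_scal (/ RInt (edge_poly d) 0 1)) in H.
- unfold node_poly, Rdiv; rewrite Rmult_comm.
  revert H; apply is_series_ext; intros n.
  unfold node_coef, PS_scal, Rdiv; f_equal; apply Rmult_comm.
- apply Rmult_comm.
Qed.

(* Main.v *)
(* With the message erasure fractions x_l (variable to check) and
   c_l = 1 - rho(1 - x_l) (check to variable), the area between the curves
   y = 1 - rho(1 - x) and x = p lambda(y) is at most eps (1 - p) int_0^1 lambda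
   by the rate assumption.  Since lambda is convex, decoding step l covers at
   least half the rectangle (c_l - c_(l+1)) (x_(l+1) - x_(l+2)) of this area.
   As L is, up to normalisation, the primitive of lambda and has no term of
   degree less than 2, Jensen's inequality gives
     (L(c_l) - L(c_(l+1)))^2
       <= 2 (c_l - c_(l+1)) (lambda(c_l) - lambda(c_(l+1))) / int_0^1 lambda,
   so by Cauchy-Schwarz l steps can decrease L(c_l) by at most O(sqrt(l eps)).
   But L must fall from L(c_0), which tends to 1 as eps -> 0, to P_b / p < 1.
   Working with the series of lambda and rho term by term avoids inverting
   either curve. *)

Require Import Defs.
From Stdlib Require Import Reals Lra Lia.
From Coquelicot Require Import Coquelicot.

Open Scope R_scope.

(** * Series of degree distributions and of their primitives on [0, 1] *)

Lemma is_series_le (a b : nat -> R) (la lb : R) :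
  (forall n, a n <= b n) -> is_series a la -> is_series b lb -> la <= lb.
Proof.
intros Hab Ha Hb.
apply (is_lim_seq_le (sum_n a) (sum_n b) la lb); [|exact Ha|exact Hb].
intros n; now apply sum_n_m_le.
Qed.

Lemma sum_n_le_series (a : nat -> R) (l : R) (n : nat) :
  (forall k, 0 <= a k) -> is_series a l -> sum_n a n <= l.
Proof.
intros Ha Hs.
apply (is_lim_seq_incr_compare (sum_n a) l Hs).
intros m; rewrite sum_Sn; pose proof (Ha (S m)); change plus with Rplus; lra.
Qed.

Lemma edge_coef_ge0 {imin : nat} (d : degree_distribution imin) (k : nat) :
  0 <= edge_coef d k.
Proof. apply coef_ge0. Qed.

Lemma edge_coef_series {imin : nat} (d : degree_distribution (S imin)) :
  is_series (edge_coef d) 1.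
Proof.
apply (is_series_ext (fun k => coef d (S k))); [reflexivity|].
apply (is_series_incr_1 (coef d) 1).
assert (E : 1 + d 0%nat = 1) by (rewrite (coef_min _ d 0) by lia; ring).
exact (eq_ind_r (fun l : R => is_series (coef d) l) (coef_sum _ d) E).
Qed.

Lemma pow_le1 (x : R) (k : nat) : 0 <= x <= 1 -> 0 <= x ^ k <= 1.
Proof.
intros Hx; split; [now apply pow_le|].
rewrite <- (pow1 k); now apply pow_incr.
Qed.

Lemma edge_poly_series {imin : nat} (d : degree_distribution (S imin)) (x : R) :
  0 <= x <= 1 -> is_series (fun k => edge_coef d k * x ^ k) (edge_poly d x).
Proof.
intros Hx.
apply Series_correct.
apply (ex_series_le (fun k => edge_coef d k * x ^ k) (edge_coef d));
  [|exists 1; apply edge_coef_series].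
intros k; unfold norm; simpl; unfold abs; simpl.
pose proof (edge_coef_ge0 d k); pose proof (pow_le1 x k Hx).
rewrite Rabs_pos_eq; nra.
Qed.

(** Each tail term at [x] is dominated by the one at 1. The resulting bound does not depend on [x],
    which makes the convergence uniform on [0, 1]. *)
Lemma edge_poly_partial {imin : nat} (d : degree_distribution (S imin))
    (x : R) (n : nat) :
  0 <= x <= 1 ->
  0 <= edge_poly d x - sum_n (fun k => edge_coef d k * x ^ k) n
    <= 1 - sum_n (edge_coef d) n.
Proof.
intros Hx; pose proof (edge_poly_series d x Hx) as Hs.
split.
- apply -> Rminus_le_0.
  apply sum_n_le_series; [|exact Hs].
  intros k; pose proof (edge_coef_ge0 d k); pose proof (pow_le1 x k Hx); nra.
- assert (H : is_series (fun k => edge_coef d k - edge_coef d k * x ^ k)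
                (1 - edge_poly d x)).
  { apply (is_series_minus _ _ _ _ (edge_coef_series d) Hs). }
  apply (sum_n_le_series _ _ n) in H.
  + assert (E : sum_n (fun k => edge_coef d k - edge_coef d k * x ^ k) n
              = sum_n (edge_coef d) n
                - sum_n (fun k => edge_coef d k * x ^ k) n).
    { clear H; induction n as [|n IH]; [now rewrite !sum_O|].
      rewrite !sum_Sn, IH; unfold plus; simpl; ring. }
    rewrite E in H; lra.
  + intros k; pose proof (edge_coef_ge0 d k); pose proof (pow_le1 x k Hx); nra.
Qed.

Lemma is_RInt_edge_partial {imin : nat} (d : degree_distribution imin)
    (x : R) (n : nat) :
  is_RInt (fun t => sum_n (fun k => edge_coef d k * t ^ k) n) 0 x
    (sum_n (fun k => edge_coef d k * (x ^ S k / INR (S k))) n).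
Proof.
assert (Hk : forall k, is_RInt (fun t => edge_coef d k * t ^ k) 0 x
               (edge_coef d k * (x ^ S k / INR (S k)))).
{ intros k.
  pose proof (is_RInt_scal _ 0 x (edge_coef d k) _ (is_RInt_pow 0 x k)) as H.
  replace (edge_coef d k * (x ^ S k / INR (S k)))
    with (scal (edge_coef d k) (x ^ S k / INR (S k) - 0 ^ S k / INR (S k)));
    [exact H|].
  unfold scal; simpl; unfold mult; simpl; unfold Rdiv; ring. }
induction n as [|n IH].
- rewrite sum_O; apply (is_RInt_ext (fun t => edge_coef d 0 * t ^ 0));
    [|apply Hk].
  intros t _; now rewrite sum_O.
- rewrite sum_Sn.
  apply (is_RInt_ext (fun t => plus (sum_n (fun k => edge_coef d k * t ^ k) n)
                                 (edge_coef d (S n) * t ^ S n))).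
  + intros t _; now rewrite sum_Sn.
  + apply (is_RInt_plus _ _ _ _ _ _ IH (Hk (S n))).
Qed.

(* [PSeries] need not be continuous at the radius of convergence, so the
   integral up to [1] is obtained from uniform convergence on [0, 1]; clamping
   the argument makes the convergence uniform on all of [R]. *)
Lemma edge_int_series {imin : nat} (d : degree_distribution (S imin)) (x : R) :
  0 <= x <= 1 ->
  is_series (fun k => edge_coef d k * (x ^ S k / INR (S k)))
    (RInt (edge_poly d) 0 x).
Proof.
intros Hx.
pose (clamp := fun t : R => Rmax 0 (Rmin 1 t)).
assert (Hc01 : forall t, 0 <= clamp t <= 1).
{ intros t; unfold clamp, Rmax, Rmin.
  destruct (Rle_dec 1 t), (Rle_dec 0 _); lra. }
assert (Hcid : forall t, Rmin 0 x < t < Rmax 0 x -> clamp t = t).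
{ intros t; rewrite Rmin_left, Rmax_right by lra; intros Ht.
  unfold clamp; rewrite Rmin_right, Rmax_right; lra. }
destruct (filterlim_RInt
  (fun n t => sum_n (fun k => edge_coef d k * clamp t ^ k) n) 0 x eventually _
  (fun t => edge_poly d (clamp t))
  (fun n => sum_n (fun k => edge_coef d k * (x ^ S k / INR (S k))) n))
  as [I [Hlim HI]].
- intros n.
  apply (is_RInt_ext (fun t => sum_n (fun k => edge_coef d k * t ^ k) n)).
  + intros t Ht; now rewrite (Hcid t Ht).
  + apply is_RInt_edge_partial.
- apply filterlim_locally; intros e.
  assert (Hs : is_lim_seq (sum_n (edge_coef d)) 1) by apply edge_coef_series.
  apply is_lim_seq_spec in Hs; destruct (Hs e) as [N HN].
  exists N; intros n Hn t.
  specialize (HN n Hn).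
  pose proof (edge_poly_partial d (clamp t) n (Hc01 t)).
  unfold ball; simpl; unfold AbsRing_ball, abs, minus, plus, opp; simpl.
  apply Rabs_def2 in HN; apply Rabs_def1; lra.
- replace (RInt (edge_poly d) 0 x) with I; [exact Hlim|].
  symmetry; apply is_RInt_unique.
  apply (is_RInt_ext (fun t => edge_poly d (clamp t))); [|exact HI].
  intros t Ht; now rewrite (Hcid t Ht).
Qed.

(** * Inequalities for differences of powers *)

Lemma pow_diff_S (a b : R) (k : nat) :
  b ^ S k - a ^ S k = b * (b ^ k - a ^ k) + a ^ k * (b - a).
Proof. simpl; ring. Qed.

Lemma pow_diff_bounds (a b : R) (k : nat) :
  0 <= a <= b ->
  INR (S k) * ((b - a) * a ^ k) <= b ^ S k - a ^ S k
    <= INR (S k) * ((b - a) * b ^ k).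
Proof.
intros Hab; induction k as [|k IH]; [simpl; lra|].
rewrite (pow_diff_S a b (S k)), (S_INR (S k)).
assert (H0 : 0 <= a ^ S k) by (apply pow_le; lra).
assert (H1 : a ^ S k <= b ^ S k) by (apply pow_incr; lra).
assert (H2 : 0 <= INR (S k)) by apply pos_INR.
assert (H3 : 0 <= a ^ k) by (apply pow_le; lra).
assert (H4 : 0 <= INR (S k) * ((b - a) * a ^ k)).
{ apply Rmult_le_pos; [lra|]; apply Rmult_le_pos; lra. }
split.
- apply Rle_trans with (a * (INR (S k) * ((b - a) * a ^ k)) + a ^ S k * (b - a)).
  + right; simpl; ring.
  + apply Rplus_le_compat_r, Rmult_le_compat; lra.
- apply Rle_trans with (b * (INR (S k) * ((b - a) * b ^ k)) + b ^ S k * (b - a)).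
  + apply Rplus_le_compat; [apply Rmult_le_compat_l; lra|].
    apply Rmult_le_compat_r; lra.
  + right; simpl; ring.
Qed.

(** Trapezoid rule for the convex function t^k, proved by induction so that no integral is
    involved. *)
Lemma pow_diff_trapezoid (a b : R) (k : nat) :
  0 <= a <= b ->
  2 * (b ^ S k - a ^ S k) <= INR (S k) * ((b - a) * (a ^ k + b ^ k)).
Proof.
intros Hab; induction k as [|k IH]; [simpl; lra|].
assert (E : 2 * (b ^ S (S k) - a ^ S (S k))
  = (a + b) / 2 * (2 * (b ^ S k - a ^ S k)) + (b - a) * (a ^ S k + b ^ S k)).
{ simpl; field. }
assert (H1 : a ^ k <= b ^ k) by (apply pow_incr; lra).
(* Chebyshev's sum inequality: twice the right side minus twice the left side is (b - a)(b^k - a^k)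
   >= 0. *)
assert (Hcheb : (a + b) / 2 * (a ^ k + b ^ k) <= a ^ S k + b ^ S k).
{ simpl; nra. }
rewrite E, (S_INR (S k)).
apply Rle_trans with ((a + b) / 2 * (INR (S k) * ((b - a) * (a ^ k + b ^ k)))
  + (b - a) * (a ^ S k + b ^ S k)).
- apply Rplus_le_compat_r, Rmult_le_compat_l; lra.
- apply Rle_trans with (INR (S k) * (b - a) * ((a + b) / 2 * (a ^ k + b ^ k))
    + (b - a) * (a ^ S k + b ^ S k)); [right; ring|].
  apply Rle_trans with (INR (S k) * (b - a) * (a ^ S k + b ^ S k)
    + (b - a) * (a ^ S k + b ^ S k)); [|right; ring].
  apply Rplus_le_compat_r, Rmult_le_compat_l; [|exact Hcheb].
  apply Rmult_le_pos; [apply pos_INR|lra].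
Qed.

(** One factor of the square is bounded by the derivative, at most k + 2 on [0, 1]; the other is at
    most twice the difference of the powers of exponent k + 1. *)
Lemma pow_diff_sqr (a b : R) (k : nat) :
  0 <= a <= b -> b <= 1 ->
  (b ^ S (S k) - a ^ S (S k)) ^ 2
    <= 2 * INR (S (S k)) * ((b - a) * (b ^ S k - a ^ S k)).
Proof.
intros Hab Hb.
pose proof (pow_diff_bounds a b (S k) Hab) as [_ Hlin].
assert (Ha : 0 <= a ^ k) by (apply pow_le; lra).
assert (Hak : a ^ k <= b ^ k) by (apply pow_incr; lra).
assert (Hbk : 0 <= b ^ S k <= 1) by (apply pow_le1; lra).
assert (HD : 0 <= b ^ S k - a ^ S k).
{ apply -> Rminus_le_0; apply pow_incr; lra. }
(* Each of the two summands in [pow_diff_S] is at most b^(k+1) - a^(k+1), whence the factor 2. *)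
assert (Hdbl : b ^ S (S k) - a ^ S (S k) <= 2 * (b ^ S k - a ^ S k)).
{ rewrite (pow_diff_S a b (S k)).
  assert (a ^ S k * (b - a) <= b ^ S k - a ^ S k).
  { rewrite (pow_diff_S a b k). simpl.
    assert (0 <= a ^ k * (b - a)) by (apply Rmult_le_pos; lra).
    assert (0 <= b * (b ^ k - a ^ k)) by (apply Rmult_le_pos; lra).
    nra. }
  nra. }
assert (HD2 : 0 <= b ^ S (S k) - a ^ S (S k)).
{ apply -> Rminus_le_0; apply pow_incr; lra. }
assert (HN : 0 <= INR (S (S k))) by apply pos_INR.
assert (Hlin' : b ^ S (S k) - a ^ S (S k) <= INR (S (S k)) * (b - a)).
{ apply Rle_trans with (1 := Hlin), Rmult_le_compat_l; [exact HN|]; nra. }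
replace ((b ^ S (S k) - a ^ S (S k)) ^ 2)
  with ((b ^ S (S k) - a ^ S (S k)) * (b ^ S (S k) - a ^ S (S k))) by ring.
apply Rle_trans with
  ((INR (S (S k)) * (b - a)) * (2 * (b ^ S k - a ^ S k))).
- now apply Rmult_le_compat.
- right; ring.
Qed.

(** * Termwise passage from powers to edge polynomials and their primitives *)

Lemma is_series_Rminus (a b : nat -> R) (la lb : R) :
  is_series a la -> is_series b lb -> is_series (fun n => a n - b n) (la - lb).
Proof. exact (is_series_minus a b la lb). Qed.

Lemma is_series_Rplus (a b : nat -> R) (la lb : R) :
  is_series a la -> is_series b lb -> is_series (fun n => a n + b n) (la + lb).
Proof. exact (is_series_plus a b la lb). Qed.

Lemma is_series_Rmult_l (c : R) (a : nat -> R) (l : R) :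
  is_series a l -> is_series (fun n => c * a n) (c * l).
Proof. exact (is_series_scal c a l). Qed.

(** The unnormalised L: [node_poly d x] is [edge_int d x / edge_int d 1]. *)
Definition edge_int {imin : nat} (d : degree_distribution imin) (x : R) : R :=
  RInt (edge_poly d) 0 x.

Lemma edge_poly_bounds {imin : nat} (d : degree_distribution (S imin)) (x : R) :
  0 <= x <= 1 -> 0 <= edge_poly d x <= 1.
Proof.
intros Hx; pose proof (edge_poly_series d x Hx) as Hs; split.
- apply Rle_trans with (sum_n (fun k => edge_coef d k * x ^ k) 0).
  + rewrite sum_O; simpl; pose proof (edge_coef_ge0 d 0); lra.
  + apply sum_n_le_series; [|exact Hs].
    intros k; pose proof (edge_coef_ge0 d k); pose proof (pow_le1 x k Hx); nra.
- apply (fun h => is_series_le _ _ _ _ h Hs (edge_coef_series d)).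
  intros k; pose proof (edge_coef_ge0 d k); pose proof (pow_le1 x k Hx); nra.
Qed.

Lemma edge_poly_incr {imin : nat} (d : degree_distribution (S imin)) (a b : R) :
  0 <= a <= b -> b <= 1 -> edge_poly d a <= edge_poly d b.
Proof.
intros Hab Hb.
apply (fun h => is_series_le _ _ _ _ h (edge_poly_series d a ltac:(lra))
  (edge_poly_series d b ltac:(lra))).
intros k; apply Rmult_le_compat_l; [apply edge_coef_ge0|now apply pow_incr].
Qed.

Lemma edge_int_diff_series {imin : nat} (d : degree_distribution (S imin))
    (a b : R) :
  0 <= a <= b -> b <= 1 ->
  is_series (fun k => edge_coef d k / INR (S k) * (b ^ S k - a ^ S k))
    (edge_int d b - edge_int d a).
Proof.
intros Hab Hb.
apply (is_series_ext (fun k => edge_coef d k * (b ^ S k / INR (S k))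
                             - edge_coef d k * (a ^ S k / INR (S k)))).
- intros k; unfold Rdiv; match goal with |- ?x = ?y => change (@eq R x y) end; ring.
- apply is_series_Rminus; apply edge_int_series; lra.
Qed.

Lemma INR_S_pos (k : nat) : 0 < INR (S k).
Proof. apply lt_0_INR; lia. Qed.

Lemma edge_int_diff_bounds {imin : nat} (d : degree_distribution (S imin))
    (a b : R) :
  0 <= a <= b -> b <= 1 ->
  (b - a) * edge_poly d a <= edge_int d b - edge_int d a
    <= (b - a) * edge_poly d b.
Proof.
intros Hab Hb; pose proof (edge_int_diff_series d a b Hab Hb) as Hs.
assert (Hterm : forall k,
  (b - a) * (edge_coef d k * a ^ k)
    <= edge_coef d k / INR (S k) * (b ^ S k - a ^ S k)
    <= (b - a) * (edge_coef d k * b ^ k)).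
{ intros k; pose proof (INR_S_pos k); pose proof (edge_coef_ge0 d k).
  pose proof (pow_diff_bounds a b k Hab) as [Hlo Hhi].
  assert (0 <= edge_coef d k / INR (S k)).
  { apply Rdiv_le_0_compat; lra. }
  split.
  - replace ((b - a) * (edge_coef d k * a ^ k))
      with (edge_coef d k / INR (S k) * (INR (S k) * ((b - a) * a ^ k)))
      by (field; lra).
    now apply Rmult_le_compat_l.
  - replace ((b - a) * (edge_coef d k * b ^ k))
      with (edge_coef d k / INR (S k) * (INR (S k) * ((b - a) * b ^ k)))
      by (field; lra).
    now apply Rmult_le_compat_l. }
split.
- apply (is_series_le _ _ _ _ (fun k => proj1 (Hterm k))); [|exact Hs].
  apply is_series_Rmult_l, edge_poly_series; lra.
- apply (is_series_le _ _ _ _ (fun k => proj2 (Hterm k))); [exact Hs|].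
  apply is_series_Rmult_l, edge_poly_series; lra.
Qed.

Lemma edge_int_trapezoid {imin : nat} (d : degree_distribution (S imin))
    (a b : R) :
  0 <= a <= b -> b <= 1 ->
  2 * (edge_int d b - edge_int d a)
    <= (b - a) * (edge_poly d a + edge_poly d b).
Proof.
intros Hab Hb.
refine (is_series_le
  (fun k => 2 * (edge_coef d k / INR (S k) * (b ^ S k - a ^ S k)))
  (fun k => (b - a) * (edge_coef d k * a ^ k + edge_coef d k * b ^ k))
  _ _ _ _ _).
- intros k; pose proof (INR_S_pos k); pose proof (edge_coef_ge0 d k).
  replace ((b - a) * (edge_coef d k * a ^ k + edge_coef d k * b ^ k))
    with (edge_coef d k / INR (S k) * (INR (S k) * ((b - a) * (a ^ k + b ^ k))))
    by (field; lra).
  replace (2 * (edge_coef d k / INR (S k) * (b ^ S k - a ^ S k)))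
    with (edge_coef d k / INR (S k) * (2 * (b ^ S k - a ^ S k))) by ring.
  apply Rmult_le_compat_l; [apply Rdiv_le_0_compat; lra|].
  now apply pow_diff_trapezoid.
- apply is_series_Rmult_l, edge_int_diff_series; lra.
- apply is_series_Rmult_l, is_series_Rplus; apply edge_poly_series; lra.
Qed.

(* Jensen's inequality for the weights [edge_coef d k / (k + 1)], in the
   linearised form [2 s u - s^2 <= u^2] with [s] the weighted mean.  There must
   be no degree-1 nodes: [pow_diff_sqr] has no analogue for linear terms. *)
Lemma edge_int_diff_sqr {imin : nat} (d : degree_distribution (S (S imin)))
    (a b : R) :
  0 <= a <= b -> b <= 1 -> 0 < edge_int d 1 ->
  (edge_int d b - edge_int d a) ^ 2
    <= 2 * edge_int d 1 * ((b - a) * (edge_poly d b - edge_poly d a)).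
Proof.
intros Hab Hb HL.
pose (s := (edge_int d b - edge_int d a) / edge_int d 1).
assert (H : 2 * s * (edge_int d b - edge_int d a) - s ^ 2 * edge_int d 1
            <= 2 * (b - a) * (edge_poly d b - edge_poly d a)).
{ refine (is_series_le
    (fun k => 2 * s * (edge_coef d k / INR (S k) * (b ^ S k - a ^ S k))
              - s ^ 2 * (edge_coef d k * (1 ^ S k / INR (S k))))
    (fun k => 2 * (b - a) * (edge_coef d k * b ^ k - edge_coef d k * a ^ k))
    _ _ _ _ _).
  - intros [|k].
    + unfold edge_coef; rewrite (coef_min _ d 1) by lia; simpl; lra.
    + pose proof (INR_S_pos (S k)); pose proof (edge_coef_ge0 d (S k)).
      set (w := edge_coef d (S k) / INR (S (S k))).
      assert (Hw : 0 <= w) by (apply Rdiv_le_0_compat; lra).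
      set (u := b ^ S (S k) - a ^ S (S k)).
      apply Rle_trans with (w * (2 * s * u - s ^ 2)).
      * right; unfold w; rewrite pow1; field; lra.
      * apply Rle_trans with
          (w * (2 * INR (S (S k)) * ((b - a) * (b ^ S k - a ^ S k)))).
        -- apply Rmult_le_compat_l; [exact Hw|].
           apply Rle_trans with (u ^ 2); [|now apply pow_diff_sqr].
           pose proof (pow2_ge_0 (u - s)); nra.
        -- right; unfold w; field; lra.
  - apply is_series_Rminus; apply is_series_Rmult_l.
    + apply edge_int_diff_series; lra.
    + apply edge_int_series; lra.
  - apply is_series_Rmult_l, is_series_Rminus; apply edge_poly_series; lra. }
assert (Es : (edge_int d b - edge_int d a) ^ 2
  = edge_int d 1 * (2 * s * (edge_int d b - edge_int d a) - s ^ 2 * edge_int d 1)).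
{ unfold s; field; lra. }
rewrite Es.
apply Rle_trans with (edge_int d 1 * (2 * (b - a) * (edge_poly d b - edge_poly d a)));
  [|right; ring].
apply Rmult_le_compat_l; lra.
Qed.

(** Split r^k = s^k s^k with s = sqrt r: one factor s^k absorbs k + 1, because (k + 1)(1 - s) s^k <=
    1 - s^(k+1), and the other tends to 0. *)
Lemma succ_mul_pow_small (r eta : R) :
  0 < r < 1 -> 0 < eta ->
  exists N : nat, forall k, (N <= k)%nat -> INR (S k) * r ^ k <= eta.
Proof.
intros Hr Heta.
pose (s := sqrt r).
assert (Hs : 0 < s < 1).
{ unfold s; split; [apply sqrt_lt_R0; lra|].
  rewrite <- sqrt_1; apply sqrt_lt_1; lra. }
destruct (pow_lt_1_zero s) with (y := eta * (1 - s)) as [N HN].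
{ rewrite Rabs_pos_eq; lra. }
{ apply Rmult_lt_0_compat; lra. }
exists N; intros k Hk; specialize (HN k Hk).
rewrite Rabs_pos_eq in HN by (apply pow_le; lra).
assert (Hb : INR (S k) * ((1 - s) * s ^ k) <= 1).
{ pose proof (pow_diff_bounds s 1 k ltac:(lra)) as [Hlo _].
  rewrite pow1 in Hlo; pose proof (pow_le s (S k) ltac:(lra)); lra. }
assert (Er : r ^ k = s ^ k * s ^ k).
{ rewrite <- Rpow_mult_distr; unfold s; now rewrite sqrt_sqrt by lra. }
assert (Hsk : 0 < s ^ k) by (apply pow_lt; lra).
apply Rmult_le_reg_l with (1 - s); [lra|].
rewrite Er; apply Rle_trans with (INR (S k) * ((1 - s) * s ^ k) * s ^ k);
  [right; ring|].
apply Rle_trans with (1 * s ^ k); [apply Rmult_le_compat_r; lra|lra].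
Qed.

(* Low degrees are controlled by the first integral, with [K] not depending
   on [d], and high degrees by the second since [(k + 1) r^k -> 0]. *)
Lemma edge_poly_le_int (r eta : R) :
  0 < r < 1 -> 0 < eta ->
  exists K : R, 0 < K /\
    forall (imin : nat) (d : degree_distribution (S imin)),
      edge_poly d r <= K * edge_int d r + eta * edge_int d 1.
Proof.
intros Hr Heta.
destruct (succ_mul_pow_small r eta Hr Heta) as [N HN].
pose proof (INR_S_pos N) as HN0.
exists (INR (S N) / r); split; [apply Rdiv_lt_0_compat; lra|].
intros imin d.
refine (is_series_le (fun k => edge_coef d k * r ^ k)
  (fun k => INR (S N) / r * (edge_coef d k * (r ^ S k / INR (S k)))
            + eta * (edge_coef d k * (1 ^ S k / INR (S k)))) _ _ _ _ _).
- intros k; pose proof (INR_S_pos k) as Hk; pose proof (edge_coef_ge0 d k).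
  assert (0 < r ^ k) by (apply pow_lt; lra).
  replace (INR (S N) / r * (edge_coef d k * (r ^ S k / INR (S k)))
            + eta * (edge_coef d k * (1 ^ S k / INR (S k))))
    with (edge_coef d k / INR (S k) * (INR (S N) * r ^ k + eta))
    by (rewrite pow1; simpl pow; field; lra).
  replace (edge_coef d k * r ^ k)
    with (edge_coef d k / INR (S k) * (INR (S k) * r ^ k)) by (field; lra).
  apply Rmult_le_compat_l; [apply Rdiv_le_0_compat; lra|].
  destruct (Nat.le_gt_cases N k) as [HNk|HNk].
  + specialize (HN k HNk).
    assert (0 <= INR (S N) * r ^ k) by (apply Rmult_le_pos; lra); lra.
  + assert (INR (S k) <= INR (S N)) by (apply le_INR; lia).
    assert (INR (S k) * r ^ k <= INR (S N) * r ^ k)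
      by (apply Rmult_le_compat_r; lra).
    lra.
- apply edge_poly_series; lra.
- apply is_series_Rplus; apply is_series_Rmult_l; apply edge_int_series; lra.
Qed.

(** * Density evolution and the area swept by the decoding staircase *)

Definition check_erasure (E : ldpc_sequence) (p : R) (l : nat) : R :=
  1 - edge_poly (cdeg E) (1 - erasure_fraction E p l).

Lemma check_erasure_bounds (E : ldpc_sequence) (p : R) (l : nat) :
  0 <= erasure_fraction E p l <= 1 -> 0 <= check_erasure E p l <= 1.
Proof.
intros Hx; unfold check_erasure.
pose proof (edge_poly_bounds (cdeg E) (1 - erasure_fraction E p l)); lra.
Qed.

Lemma erasure_fraction_S (E : ldpc_sequence) (p : R) (l : nat) :
  erasure_fraction E p (S l) = p * edge_poly (vdeg E) (check_erasure E p l).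
Proof. reflexivity. Qed.

Lemma erasure_fraction_bounds (E : ldpc_sequence) (p : R) (l : nat) :
  0 <= p <= 1 -> 0 <= erasure_fraction E p l <= p.
Proof.
intros Hp; induction l as [|l IH]; [simpl; lra|].
rewrite erasure_fraction_S.
pose proof (check_erasure_bounds E p l ltac:(lra)) as Hc.
pose proof (edge_poly_bounds (vdeg E) _ Hc); nra.
Qed.

Lemma check_erasure_le (E : ldpc_sequence) (p : R) (l m : nat) :
  0 <= p <= 1 -> erasure_fraction E p l <= erasure_fraction E p m ->
  check_erasure E p l <= check_erasure E p m.
Proof.
intros Hp Hlm; unfold check_erasure.
pose proof (erasure_fraction_bounds E p l Hp).
pose proof (erasure_fraction_bounds E p m Hp).
pose proof (edge_poly_incr (cdeg E) (1 - erasure_fraction E p m)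
  (1 - erasure_fraction E p l)); lra.
Qed.

Lemma erasure_fraction_decr (E : ldpc_sequence) (p : R) (l : nat) :
  0 <= p <= 1 -> erasure_fraction E p (S l) <= erasure_fraction E p l.
Proof.
intros Hp; induction l as [|l IH].
- apply (erasure_fraction_bounds E p 1 Hp).
- rewrite (erasure_fraction_S E p l), (erasure_fraction_S E p (S l)).
  apply Rmult_le_compat_l; [lra|].
  pose proof (erasure_fraction_bounds E p l Hp).
  pose proof (erasure_fraction_bounds E p (S l) Hp).
  pose proof (check_erasure_bounds E p l ltac:(lra)).
  pose proof (check_erasure_bounds E p (S l) ltac:(lra)).
  pose proof (check_erasure_le E p (S l) l Hp IH).
  apply edge_poly_incr; lra.
Qed.

(* With [x_l], [c_l] the erasure fractions of the two kinds of messages, this is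
   [int_(x_l)^1 (1 - c(x)) dx + x_l (1 - c_l) - int_(c_l)^(c_0) p lambda(y) dy],
   where [c(x) = 1 - rho(1 - x)]: the part of the unit square above the curve
   [c], minus the part left of the curve [x = p lambda(y)], as seen by the first
   [l] steps of the decoding staircase. *)
Definition staircase_area (E : ldpc_sequence) (p : R) (l : nat) : R :=
  edge_int (cdeg E) (1 - erasure_fraction E p l)
  + erasure_fraction E p l * (1 - check_erasure E p l)
  - p * (edge_int (vdeg E) (check_erasure E p 0)
         - edge_int (vdeg E) (check_erasure E p l)).

(* The trapezoid rule applied to the convex [lambda] makes each step gain
   half of the rectangle [(c_l - c_(l+1)) (x_(l+1) - x_(l+2))]. *)
Lemma staircase_area_step (E : ldpc_sequence) (p : R) (l : nat) :
  0 < p <= 1 -> 0 < edge_int (vdeg E) 1 ->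
  p / (4 * edge_int (vdeg E) 1)
    * (edge_int (vdeg E) (check_erasure E p l)
       - edge_int (vdeg E) (check_erasure E p (S l))) ^ 2
  <= staircase_area E p (S l) - staircase_area E p l.
Proof.
intros Hp HL.
pose proof (erasure_fraction_bounds E p l ltac:(lra)) as Hx.
pose proof (erasure_fraction_bounds E p (S l) ltac:(lra)) as Hx'.
pose proof (erasure_fraction_decr E p l ltac:(lra)) as Hxx'.
pose proof (check_erasure_bounds E p l ltac:(lra)) as Hc.
pose proof (check_erasure_bounds E p (S l) ltac:(lra)) as Hc'.
pose proof (check_erasure_le E p (S l) l ltac:(lra) Hxx') as Hcc'.
pose proof (edge_int_diff_bounds (cdeg E) (1 - erasure_fraction E p l)
  (1 - erasure_fraction E p (S l)) ltac:(lra) ltac:(lra)) as [Hrho _].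
replace (edge_poly (cdeg E) (1 - erasure_fraction E p l))
  with (1 - check_erasure E p l) in Hrho by (unfold check_erasure; ring).
pose proof (edge_int_trapezoid (vdeg E) (check_erasure E p (S l))
  (check_erasure E p l) ltac:(lra) ltac:(lra)) as Htrap.
pose proof (edge_int_diff_sqr (vdeg E) (check_erasure E p (S l))
  (check_erasure E p l) ltac:(lra) ltac:(lra) HL) as Hsqr.
unfold staircase_area.
pose proof (erasure_fraction_S E p l) as Ex.
set (x := erasure_fraction E p l) in *.
set (x' := erasure_fraction E p (S l)) in *.
set (c := check_erasure E p l) in *.
set (c' := check_erasure E p (S l)) in *.
set (F := edge_int (vdeg E)) in *.
set (G := edge_int (cdeg E)) in *.
set (v := edge_poly (vdeg E) c) in *.
set (v' := edge_poly (vdeg E) c') in *.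
apply Rle_trans with (p / 2 * ((c - c') * (v - v'))).
- replace (p / 2 * ((c - c') * (v - v')))
    with (p / (4 * F 1) * (2 * F 1 * ((c - c') * (v - v')))) by (field; lra).
  apply Rmult_le_compat_l; [apply Rdiv_le_0_compat; lra|exact Hsqr].
(* The bound [Hrho] on the integral of rho leaves a gain of at least x' (c - c') - p (F c - F c').
   Since x' = p v, the trapezoid rule bounds this below by p (c - c')(v - v') / 2. *)
- assert (p * (2 * (F c - F c')) <= p * ((c - c') * (v' + v)))
    by (apply Rmult_le_compat_l; lra).
  rewrite Ex in *; nra.
Qed.

Lemma staircase_area_incr (E : ldpc_sequence) (p : R) (l m : nat) :
  0 < p <= 1 -> 0 < edge_int (vdeg E) 1 -> (l <= m)%nat ->
  staircase_area E p l <= staircase_area E p m.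
Proof.
intros Hp HL Hlm; induction Hlm as [|m Hlm IH]; [lra|].
pose proof (staircase_area_step E p m Hp HL) as Hstep.
assert (0 <= p / (4 * edge_int (vdeg E) 1)
  * (edge_int (vdeg E) (check_erasure E p m)
     - edge_int (vdeg E) (check_erasure E p (S m))) ^ 2).
{ apply Rmult_le_pos; [apply Rdiv_le_0_compat; lra|apply pow2_ge_0]. }
lra.
Qed.

(* Linearised Cauchy-Schwarz: [t] is to be chosen as the mean drop per step. *)
Lemma staircase_area_gain (E : ldpc_sequence) (p t : R) (l : nat) :
  0 < p <= 1 -> 0 < edge_int (vdeg E) 1 ->
  p / (4 * edge_int (vdeg E) 1)
    * (2 * t * (edge_int (vdeg E) (check_erasure E p 0)
                - edge_int (vdeg E) (check_erasure E p l)) - INR l * t ^ 2)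
  <= staircase_area E p l - staircase_area E p 0.
Proof.
intros Hp HL; induction l as [|l IH]; [simpl; lra|].
pose proof (staircase_area_step E p l Hp HL) as Hstep.
set (F := edge_int (vdeg E)) in *.
set (k := p / (4 * F 1)) in *.
assert (Hk : 0 <= k) by (apply Rdiv_le_0_compat; lra).
set (u := F (check_erasure E p l) - F (check_erasure E p (S l))) in *.
assert (k * (2 * t * u - t ^ 2) <= k * u ^ 2).
{ apply Rmult_le_compat_l; [exact Hk|].
  pose proof (pow2_ge_0 (u - t)); nra. }
rewrite S_INR.
replace (F (check_erasure E p 0) - F (check_erasure E p (S l)))
  with (F (check_erasure E p 0) - F (check_erasure E p l) + u)
  by (unfold u; ring).
nra.
Qed.

Lemma bit_erasure_prob_int (E : ldpc_sequence) (p : R) (l : nat) :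
  bit_erasure_prob E p l
  = p * (edge_int (vdeg E) (check_erasure E p l) / edge_int (vdeg E) 1).
Proof. reflexivity. Qed.

(** The area increases with l, and its limit is controlled because successful decoding sends the
    primitive of lambda at c_l to 0. The part of that primitive between c_0 and 1 is at most 1 -
    c_0, so the term p (1 - c_0) of the initial area pays for it. *)
Lemma staircase_area_le (E : ldpc_sequence) (p : R) (l : nat) :
  0 < p <= 1 -> 0 < edge_int (vdeg E) 1 ->
  is_lim_seq (bit_erasure_prob E p) 0 ->
  staircase_area E p l - staircase_area E p 0
    <= edge_int (cdeg E) 1 - p * edge_int (vdeg E) 1
       - edge_int (cdeg E) (1 - p).
Proof.
intros Hp HL Hlim.
assert (Hbound : staircase_area E p l
  <= edge_int (cdeg E) 1 - p * edge_int (vdeg E) (check_erasure E p 0)).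
(* For each n the area at index n + l is within the claimed bound up to [edge_int (vdeg E) 1] times
   the bit erasure probability, which vanishes as n grows. *)
{ apply (is_lim_seq_le (fun _ => staircase_area E p l)
    (fun n => edge_int (cdeg E) 1
              - p * edge_int (vdeg E) (check_erasure E p 0)
              + edge_int (vdeg E) 1 * bit_erasure_prob E p (n + l))
    (staircase_area E p l)
    (edge_int (cdeg E) 1 - p * edge_int (vdeg E) (check_erasure E p 0))).
  - intros n.
    apply Rle_trans with (staircase_area E p (n + l));
      [apply staircase_area_incr; [exact Hp|exact HL|lia]|].
    set (m := (n + l)%nat).
    rewrite bit_erasure_prob_int; unfold staircase_area.
    pose proof (erasure_fraction_bounds E p m ltac:(lra)) as Hx.
    pose proof (edge_int_diff_bounds (cdeg E) (1 - erasure_fraction E p m) 1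
      ltac:(lra) ltac:(lra)) as [Hrho _].
    replace (edge_poly (cdeg E) (1 - erasure_fraction E p m))
      with (1 - check_erasure E p m) in Hrho by (unfold check_erasure; ring).
    replace (edge_int (vdeg E) 1 * (p * (edge_int (vdeg E) (check_erasure E p m)
      / edge_int (vdeg E) 1))) with (p * edge_int (vdeg E) (check_erasure E p m))
      by (field; lra).
    lra.
  - apply is_lim_seq_const.
  - apply (is_lim_seq_incr_n _ l) in Hlim.
    apply (is_lim_seq_scal_l _ (edge_int (vdeg E) 1)) in Hlim.
    pose proof (is_lim_seq_plus' _ _ _ _
      (is_lim_seq_const (edge_int (cdeg E) 1
        - p * edge_int (vdeg E) (check_erasure E p 0))) Hlim) as H.
    simpl in H; rewrite Rmult_0_r, Rplus_0_r in H; exact H. }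
pose proof (check_erasure_bounds E p 0 ltac:(simpl; lra)) as Hc.
pose proof (edge_int_diff_bounds (vdeg E) (check_erasure E p 0) 1
  ltac:(lra) ltac:(lra)) as [_ Hlam].
pose proof (edge_poly_bounds (vdeg E) 1 ltac:(lra)).
assert (edge_int (vdeg E) 1 - edge_int (vdeg E) (check_erasure E p 0)
  <= 1 - check_erasure E p 0) by nra.
assert (p * (edge_int (vdeg E) 1 - edge_int (vdeg E) (check_erasure E p 0))
  <= p * (1 - check_erasure E p 0)) by (apply Rmult_le_compat_l; lra).
assert (E0 : staircase_area E p 0
  = edge_int (cdeg E) (1 - p) + p * (1 - check_erasure E p 0)).
{ unfold staircase_area; simpl erasure_fraction; ring. }
lra.
Qed.

(** * Consequences of the rate assumption and the bound on iterations *)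

Lemma edge_int_gap (E : ldpc_sequence) (p eps : R) :
  0 < edge_int (vdeg E) 1 -> (1 - eps) * bec_capacity p <= design_rate E ->
  edge_int (cdeg E) 1 - p * edge_int (vdeg E) 1
    <= eps * (1 - p) * edge_int (vdeg E) 1.
Proof.
intros HL; unfold bec_capacity, design_rate.
change (RInt (edge_poly (cdeg E)) 0 1) with (edge_int (cdeg E) 1).
change (RInt (edge_poly (vdeg E)) 0 1) with (edge_int (vdeg E) 1).
set (G := edge_int (cdeg E) 1); set (F := edge_int (vdeg E) 1) in *.
intros Hrate.
(* G / F = 1 - R <= 1 - (1 - eps)(1 - p) = p + eps (1 - p). *)
assert (H : G / F * F <= (p + eps * (1 - p)) * F)
  by (apply Rmult_le_compat_r; lra).
replace (G / F * F) with G in H by (field; lra); lra.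
Qed.

Lemma edge_int_0 {imin : nat} (d : degree_distribution imin) :
  edge_int d 0 = 0.
Proof. exact (RInt_point 0 (edge_poly d)). Qed.

Lemma edge_int_ge0 {imin : nat} (d : degree_distribution (S imin)) (x : R) :
  0 <= x <= 1 -> 0 <= edge_int d x.
Proof.
intros Hx.
pose proof (edge_int_diff_bounds d 0 x ltac:(lra) ltac:(lra)) as [H _].
pose proof (edge_poly_bounds d 0 ltac:(lra)).
rewrite edge_int_0 in H; nra.
Qed.

Lemma node_coef_2 {imin : nat} (d : degree_distribution imin) :
  node_coef d 2 = edge_coef d 1 / 2 / edge_int d 1.
Proof. unfold node_coef, PS_Int, edge_int; simpl; reflexivity. Qed.

Lemma edge_int_1_pos {imin : nat} (d : degree_distribution (S imin)) :
  0 < node_coef d 2 -> 0 < edge_int d 1.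
Proof.
intros H; pose proof (edge_int_ge0 d 1 ltac:(lra)) as [HL|HL]; [exact HL|].
(* As [/ 0] is 0, a vanishing integral would make [node_coef d 2] zero. *)
rewrite node_coef_2, <- HL in H; unfold Rdiv in H.
rewrite Rinv_0, Rmult_0_r in H; lra.
Qed.

Lemma node_coef_2_le1 {imin : nat} (d : degree_distribution (S imin)) :
  0 < edge_int d 1 -> node_coef d 2 <= 1.
Proof.
intros HL; rewrite node_coef_2.
apply Rle_div_l; [exact HL|rewrite Rmult_1_l].
apply Rle_trans with
  (sum_n (fun k => edge_coef d k * (1 ^ S k / INR (S k))) 1).
- rewrite sum_Sn, sum_O; pose proof (edge_coef_ge0 d 0).
  unfold plus; simpl; lra.
- apply sum_n_le_series; [|apply edge_int_series; lra].
  intros k; rewrite pow1; apply Rmult_le_pos; [apply edge_coef_ge0|].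
  apply Rdiv_le_0_compat; [lra|apply INR_S_pos].
Qed.

(** Quantifies L(c_0) -> 1 uniformly in the ensemble. The area bound at l = 0 makes the integral of
    rho over [0, 1 - p] at most eps (1 - p) times that of lambda over [0, 1]; [edge_poly_le_int]
    turns this into smallness of rho(1 - p) = 1 - c_0. *)
Lemma initial_node_loss (p eta : R) :
  0 < p < 1 -> 0 < eta ->
  exists delta : R, 0 < delta /\
    forall (E : ldpc_sequence) (eps : R),
      0 < eps <= delta -> 0 < edge_int (vdeg E) 1 ->
      achieves_capacity_fraction E p eps ->
      (1 - eta) * edge_int (vdeg E) 1
        <= edge_int (vdeg E) (check_erasure E p 0).
Proof.
intros Hp Heta.
destruct (edge_poly_le_int (1 - p) (eta / 2)) as [K [HK HKd]]; [lra|lra|].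
assert (HeK : 0 < eta / (2 * K)) by (apply Rdiv_lt_0_compat; lra).
(* eps <= 1 gives [G 1 <= F 1], and eps <= eta / (2 K) gives K eps <= eta / 2; each accounts for
   half of eta. *)
exists (Rmin 1 (eta / (2 * K))); split; [now apply Rmin_pos; [lra|]|].
intros E eps Heps HL [Hrate Hlim].
pose proof (Rmin_l 1 (eta / (2 * K))); pose proof (Rmin_r 1 (eta / (2 * K))).
pose proof (edge_int_gap E p eps HL Hrate) as Hgap.
pose proof (staircase_area_le E p 0 ltac:(lra) HL Hlim) as Harea.
specialize (HKd _ (cdeg E)).
pose proof (check_erasure_bounds E p 0 ltac:(simpl; lra)) as Hc.
pose proof (edge_int_diff_bounds (vdeg E) (check_erasure E p 0) 1
  ltac:(lra) ltac:(lra)) as [_ Hlam].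
pose proof (edge_poly_bounds (vdeg E) 1 ltac:(lra)) as Hv1.
assert (Ec : 1 - check_erasure E p 0 = edge_poly (cdeg E) (1 - p))
  by (unfold check_erasure; simpl; ring).
set (F := edge_int (vdeg E)) in *; set (G := edge_int (cdeg E)) in *.
assert (HKeps : K * eps <= eta / 2).
{ apply Rle_trans with (K * (eta / (2 * K))).
  - apply Rmult_le_compat_l; lra.
  - right; field; lra. }
assert (Hq : eps * (1 - p) <= eps) by nra.
assert (HG1 : G 1 <= F 1).
{ assert (eps * (1 - p) * F 1 <= (1 - p) * F 1)
    by (apply Rmult_le_compat_r; nra).
  lra. }
assert (HGp : K * G (1 - p) <= eta / 2 * F 1).
{ apply Rle_trans with (K * (eps * F 1)).
  - apply Rmult_le_compat_l; [lra|].
    assert (eps * (1 - p) * F 1 <= eps * F 1) by (apply Rmult_le_compat_r; lra).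
    lra.
  - rewrite <- Rmult_assoc; apply Rmult_le_compat_r; lra. }
assert (eta / 2 * G 1 <= eta / 2 * F 1) by (apply Rmult_le_compat_l; lra).
nra.
Qed.

(** A total drop of L by [delta] over l steps costs area of order delta^2 / (l + 1), while only eps
    (1 - p) [edge_int (vdeg E) 1] is available. *)
Lemma iterations_lower_bound (E : ldpc_sequence) (p eps delta : R) (l : nat) :
  0 < p < 1 -> 0 < edge_int (vdeg E) 1 ->
  achieves_capacity_fraction E p eps -> 0 < delta ->
  delta * edge_int (vdeg E) 1
    <= edge_int (vdeg E) (check_erasure E p 0)
       - edge_int (vdeg E) (check_erasure E p l) ->
  p * delta ^ 2 <= 4 * (1 - p) * eps * INR (S l).
Proof.
intros Hp HL [Hrate Hlim] Hdelta Hdrop.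
pose proof (edge_int_gap E p eps HL Hrate) as Hgap.
pose proof (staircase_area_le E p l ltac:(lra) HL Hlim) as Harea.
pose proof (edge_int_ge0 (cdeg E) (1 - p) ltac:(lra)) as HG.
pose proof (INR_S_pos l) as Hl.
(* The drop is averaged over l + 1 rather than l steps: this stays defined at l = 0, and l + 1 is
   the iteration count to be bounded. *)
pose proof (staircase_area_gain E p (delta * edge_int (vdeg E) 1 / INR (S l)) l
  ltac:(lra) HL) as Hgain.
set (F := edge_int (vdeg E)) in *.
set (D := F (check_erasure E p 0) - F (check_erasure E p l)) in *.
set (N := INR (S l)) in *.
assert (HlN : INR l <= N) by (apply le_INR; lia).
set (t := delta * F 1 / N) in *.
assert (Ht : 0 < t).
{ apply Rdiv_lt_0_compat; [apply Rmult_lt_0_compat|]; lra. }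
assert (Hquad : t * (delta * F 1) <= 2 * t * D - INR l * t ^ 2).
{ assert (t * (delta * F 1) <= t * D) by (apply Rmult_le_compat_l; lra).
  assert (INR l * t ^ 2 <= N * t ^ 2)
    by (apply Rmult_le_compat_r; [apply pow2_ge_0|lra]).
  assert (N * t ^ 2 = t * (delta * F 1)) by (unfold t; field; lra).
  lra. }
assert (Hk : 0 < p / (4 * F 1)) by (apply Rdiv_lt_0_compat; lra).
assert (Hmain : p / (4 * F 1) * (t * (delta * F 1)) <= eps * (1 - p) * F 1).
{ apply Rle_trans with (p / (4 * F 1) * (2 * t * D - INR l * t ^ 2));
    [apply Rmult_le_compat_l; lra|lra]. }
assert (E1 : p * delta ^ 2
  = 4 * N / F 1 * (p / (4 * F 1) * (t * (delta * F 1)))).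
{ unfold t; field; lra. }
rewrite E1.
apply Rle_trans with (4 * N / F 1 * (eps * (1 - p) * F 1));
  [|right; field; lra].
apply Rmult_le_compat_l; [apply Rdiv_le_0_compat; lra|exact Hmain].
Qed.

Theorem corollary1 (p Pb eps0 L2lim : R) (E : R -> ldpc_sequence)
    (hp : 0 < p < 1) (hPb : 0 <= Pb) (heps0 : 0 < eps0)
    (hE : forall eps : R, 0 < eps < eps0 ->
        achieves_capacity_fraction (E eps) p eps)
    (hL2 : filterlim (fun eps : R => node_coef (vdeg (E eps)) 2)
        (at_right 0) (locally L2lim))
    (hL2pos : 0 < L2lim)
    (hPbL2 : forall eps : R, 0 < eps < eps0 ->
        Pb < p * node_coef (vdeg (E eps)) 2) :
  is_Omega_at_0 (fun eps : R => num_iterations (E eps) p Pb)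
    (fun eps : R => 1 / eps).
Proof.
assert (HL : forall eps, 0 < eps < eps0 -> 0 < edge_int (vdeg (E eps)) 1).
{ intros eps Heps; apply edge_int_1_pos.
  pose proof (hPbL2 eps Heps); nra. }
(* Since L_2 <= 1, one admissible eps suffices. *)
assert (HPbp : Pb < p).
{ assert (H : 0 < eps0 / 2 < eps0) by lra.
  pose proof (node_coef_2_le1 (vdeg (E (eps0 / 2))) (HL _ H)).
  pose proof (hPbL2 _ H); nra. }
(* L has to fall from 1 to Pb / p = 1 - gamma. Half of gamma is allowed for L(c_0) being below 1;
   the other half must be covered by the staircase. *)
set (gamma := 1 - Pb / p).
assert (Hgamma : 0 < gamma).
{ unfold gamma; assert (Pb / p < 1) by (apply Rlt_div_l; lra); lra. }
destruct (initial_node_loss p (gamma / 2) hp) as [delta0 [Hd0 Hinit]]; [lra|].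
set (c := p * (gamma / 2) ^ 2 / (4 * (1 - p))).
assert (Hc : 0 < c).
{ apply Rdiv_lt_0_compat; [|lra].
  apply Rmult_lt_0_compat; [lra|apply pow_lt; lra]. }
exists c, (Rmin delta0 (eps0 / 2)); split; [exact Hc|split].
{ apply Rmin_pos; lra. }
intros eps Heps.
pose proof (Rmin_l delta0 (eps0 / 2)); pose proof (Rmin_r delta0 (eps0 / 2)).
assert (Heps0 : 0 < eps < eps0) by lra.
split.
{ apply Rmult_le_pos; [lra|apply Rdiv_le_0_compat; lra]. }
unfold num_iterations.
destruct (LPO_min _ _) as [[l Hmin]|]; [|exact I].
destruct Hmin as [[Hl1 Hl] Hmin]; cbn [proj1_sig Rbar_le]; clear Hmin.
destruct l as [|l]; [lia|].
(* Counting from 0, l + 1 iterations end at index l, in agreement with [INR (S l)] in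
   [iterations_lower_bound]. *)
replace (S l - 1)%nat with l in Hl by lia.
specialize (HL eps Heps0).
specialize (Hinit (E eps) eps ltac:(lra) HL (hE eps Heps0)).
rewrite bit_erasure_prob_int in Hl.
assert (HFl : edge_int (vdeg (E eps)) (check_erasure (E eps) p l)
              <= Pb / p * edge_int (vdeg (E eps)) 1).
{ apply Rle_div_l; [exact HL|].
  apply Rmult_le_reg_l with p; [lra|].
  replace (p * (Pb / p)) with Pb by (field; lra); exact Hl. }
pose proof (iterations_lower_bound (E eps) p eps (gamma / 2) l hp HL
  (hE eps Heps0) ltac:(lra)) as Hbound.
replace (c * (1 / eps)) with (p * (gamma / 2) ^ 2 / (4 * (1 - p) * eps))
  by (unfold c; field; lra).
apply Rle_div_l; [apply Rmult_lt_0_compat; lra|].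
rewrite (Rmult_comm (INR _)); apply Hbound.
(* L(c_0) >= 1 - gamma / 2 and L(c_l) <= 1 - gamma, so the drop is at least gamma / 2. *)
replace (Pb / p) with (1 - gamma) in HFl by (unfold gamma; ring).
lra.
Qed.
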